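(* Let $\varphi$ be a $C^1$-process on $\mathbb{I}$ with $\varphi(\cdot,t_-,0)=0$, let $\Phi\in\mathcal{LP}(\mathbb{I},\mathbb{R}^n)$ be the linearization of $\varphi$ along $\varphi(\cdot,t_-,0)=0$, and suppose that the function $m$ is continuous at $0$. For $(t,Y)\in\mathbb{I}\times\mathrm{Gr}(1,\mathbb{R}^n)$ define $$\eta(t,Y)=\inf\{r>0:\exists y\in Y\cap\mathcal{S},\ ry\notin\mathcal{W}^{\mathrm s}_0(t)\},\qquad \hat\eta(t,Y)=\inf\{r>0:\exists y\in Y\cap\mathcal{S},\ ry\notin\mathcal{W}^{\mathrm u}_0(t)\}$$ (with $\inf\emptyset=\infty$). Then for each $t\in\mathbb{I}$ one has $\eta(t,Y)>0$ for every $Y\in\mathrm{Gr}(1,\mathbb{R}^n)$ with $Y\subseteq\mathcal{V}^{\mathrm s}_\Phi(t)$, and $\hat\eta(t,Y)>0$ for every $Y\in\mathrm{Gr}(1,\mathbb{R}^n)$ with $Y\subseteq\mathcal{V}^{\mathrm u}_\Phi(t)$.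
   Context: Let $n\ge 1$, let $|\cdot|$ be an arbitrary fixed norm on $\mathbb{R}^n$ with unit sphere $\mathcal{S}$, closed balls $B[0,\delta]$ and induced operator norm $\|\cdot\|$. Let $\mathbb{I}\subset\mathbb{R}$ be compact (not necessarily an interval), $t_-=\min\mathbb{I}<t_+=\max\mathbb{I}$. Put $\mathbb{I}^2_{\neq}=\{(t,s)\in\mathbb{I}\times\mathbb{I}: t\neq s\}$ with closure $\overline{\mathbb{I}^2_{\neq}}$ in $\mathbb{R}^2$. A process on $\mathbb{I}$ is a continuous map $\varphi:\mathbb{I}\times\mathbb{I}\times\mathbb{R}^n\to\mathbb{R}^n$, $(t,s,x)\mapsto\varphi(t,s,x)$, Lipschitz continuous in the first argument, with $\varphi(t,t,\cdot)=\mathrm{id}$ and $\varphi(t,s,\cdot)\circ\varphi(s,r,\cdot)=\varphi(t,r,\cdot)$ for all $t,s,r\in\mathbb{I}$. It is a $C^k$-process ($k\ge1$) if $\varphi(t,s,\cdot)\in C^k(\mathbb{R}^n,\mathbb{R}^n)$ for all $t,s$ and the space derivative $t\mapsto\partial_x\varphi(t,s,x)$ is Lipschitz continuous for all $s,x$. A linear process is a process $\Phi(t,s,x)=\Phi(t,s)x$ with $\Phi(t,s)\in GL(n,\mathbb{R})$ and $t\mapsto\Phi(t,s)$ Lipschitz continuous in operator norm. For continuous $f:\mathbb{I}\to(0,\infty)$ let $\Delta(f)(t,s)=\frac{\ln f(t)-\ln f(s)}{t-s}$, $(t,s)\in\mathbb{I}^2_{\neq}$. Standing assumption: $\mathcal{LP}(\mathbb{I},\mathbb{R}^n)$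 is the set of linear processes $\Phi$ for which $(x,t,s)\mapsto\Delta(|\Phi(\cdot,t_-)x|)(t,s)$ extends continuously from $\mathcal{S}\times\mathbb{I}^2_{\neq}$ to $\mathcal{S}\times\overline{\mathbb{I}^2_{\neq}}$ (same symbol for the extension). The linearization of $\varphi$ along $\varphi(\cdot,t_-,x)$ is $\Phi(t,s)=\partial_x\varphi(t,s,\varphi(s,t_-,x))$; along the zero trajectory, $\Phi(t,s)=\partial_x\varphi(t,s,0)$. $\mathrm{Gr}(1,\mathbb{R}^n)$ is the set of one-dimensional subspaces. For $X\in\mathrm{Gr}(1,\mathbb{R}^n)$, $\underline{\lambda}(X,\Phi)$ and $\overline{\lambda}(X,\Phi)$ are the minimum and maximum of $\Delta(|\Phi(\cdot,t_-)x|)(t,s)$ over $x\in X\cap\mathcal{S}$, $(t,s)\in\overline{\mathbb{I}^2_{\neq}}$. Stable and unstable cones: $V^{\mathrm s}(\Phi)=\bigcup\{X\in\mathrm{Gr}(1,\mathbb{R}^n):\overline{\lambda}(X,\Phi)<0\}$, $V^{\mathrm u}(\Phi)=\bigcup\{X\in\mathrm{Gr}(1,\mathbb{R}^n):\underline{\lambda}(X,\Phi)>0\}$. For $x\neq0$ and a process $\psi$ with $\psi(\cdot,t_-,0)=0$ put $\underline{\mu}(x,\psi)=\inf_{(t,s)\in\mathbb{I}^2_{\neq}}\Delta(|\psi(\cdot,t_-,x)|)(t,s)$ and $\overline{\mu}(x,\psi)=\sup_{(t,s)\in\mathbb{I}^2_{\neq}}\Delta(|\psi(\cdot,t_-,x)|)(t,s)$.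 Define $m(0)=0$ and, for $r>0$, $$m(r)=\sup_{x\in B[0,r]\setminus\{0\}}\max\{|\underline{\mu}(x,\varphi)-\underline{\mu}(x,\Phi)|,|\overline{\mu}(x,\varphi)-\overline{\mu}(x,\Phi)|\}\in[0,\infty].$$ Domains of attraction and repulsion of the zero trajectory: $W^{\mathrm s}_0=\{x\neq0:\overline{\mu}(x,\varphi)<0\}\cup\{0\}$, $W^{\mathrm u}_0=\{x\neq0:\underline{\mu}(x,\varphi)>0\}\cup\{0\}$. Time-extensions ($t$-fibers), $t\in\mathbb{I}$: $\mathcal{V}^{\mathrm s}_\Phi(t)=\Phi(t,t_-)[V^{\mathrm s}(\Phi)]$, $\mathcal{V}^{\mathrm u}_\Phi(t)=\Phi(t,t_-)[V^{\mathrm u}(\Phi)]$, $\mathcal{W}^{\mathrm s}_0(t)=\varphi(t,t_-,[W^{\mathrm s}_0])$, $\mathcal{W}^{\mathrm u}_0(t)=\varphi(t,t_-,[W^{\mathrm u}_0])$, where brackets denote images of sets. *)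

(* Defs.v *)
From HB Require Import structures.
From mathcomp Require Import all_boot all_order all_algebra.
From mathcomp Require Import all_classical all_reals all_analysis.

Set Implicit Arguments.
Unset Strict Implicit.
Unset Printing Implicit Defensive.

Import Order.TTheory GRing.Theory Num.Theory.
Import numFieldNormedType.Exports.

Local Open Scope classical_set_scope.
Local Open Scope ring_scope.

(* Vectors of R^n are row vectors, so a matrix A acts by x |-> x *m A; this is
   the convention of the library's Jacobian 'J f x, for which the derivative of
   f at x is v |-> v *m 'J f x. The topologies on 'rV[R]_n and 'M[R]_n are the
   library's (entrywise); they are those induced by any norm nu. *)

Definition is_norm (R : realType) (n : nat) (nu : 'rV[R]_n -> R) : Prop :=
  [/\ forall x y, nu (x + y) <= nu x + nu y,
      forall (a : R) x, nu (a *: x) = `|a| * nu x &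
      forall x, nu x = 0 -> x = 0].

Definition sphere (R : realType) (n : nat) (nu : 'rV[R]_n -> R) :
  set 'rV[R]_n := [set x | nu x = 1].

Definition cball (R : realType) (n : nat) (nu : 'rV[R]_n -> R) (r : R) :
  set 'rV[R]_n := [set x | nu x <= r].

Definition opnorm (R : realType) (n : nat) (nu : 'rV[R]_n -> R)
  (A : 'M[R]_n) : R := sup [set nu (x *m A) | x in sphere nu].

Definition is_min (R : realType) (A : set R) (a : R) : Prop :=
  A a /\ lbound A a.
Definition is_max (R : realType) (A : set R) (a : R) : Prop :=
  A a /\ ubound A a.

(* The minimum and the maximum of A, with junk value 0 if there is none. *)
Definition minset (R : realType) (A : set R) : R := xget 0 (is_min A).
Definition maxset (R : realType) (A : set R) : R := xget 0 (is_max A).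

Definition offdiag (R : realType) (I : set R) : set (R * R) :=
  [set p | [/\ I p.1, I p.2 & p.1 != p.2]].

Definition lipschitz_wrt (R : realType) (V : zmodType) (nu : V -> R)
  (I : set R) (f : R -> V) : Prop :=
  exists L : R, forall t t', I t -> I t' -> nu (f t - f t') <= L * `|t - t'|.

(* Processes are total functions; only their values at times in I matter. *)
Definition is_process (R : realType) (n : nat) (nu : 'rV[R]_n -> R)
    (I : set R) (phi : R -> R -> 'rV[R]_n -> 'rV[R]_n) : Prop :=
  [/\ {within (I `*` I) `*` [set: 'rV[R]_n],
        continuous (fun p : (R * R) * 'rV[R]_n => phi p.1.1 p.1.2 p.2)},
      forall s x, I s -> lipschitz_wrt nu I (fun t => phi t s x),
      forall t x, I t -> phi t t x = x &
      forall t s r x, I t -> I s -> I r ->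
        phi t s (phi s r x) = phi t r x].

Definition is_C1process (R : realType) (n : nat) (nu : 'rV[R]_n -> R)
    (I : set R) (phi : R -> R -> 'rV[R]_n -> 'rV[R]_n) : Prop :=
  [/\ is_process nu I phi,
      forall t s, I t -> I s ->
        (forall x, differentiable (phi t s) x) /\
        continuous (fun x => 'J (phi t s) x) &
      forall s x, I s ->
        lipschitz_wrt (opnorm nu) I (fun t => 'J (phi t s) x)].

Definition linproc (R : realType) (n : nat) (Phi : R -> R -> 'M[R]_n) :
  R -> R -> 'rV[R]_n -> 'rV[R]_n := fun t s x => x *m Phi t s.

Definition is_linear_process (R : realType) (n : nat) (nu : 'rV[R]_n -> R)
    (I : set R) (Phi : R -> R -> 'M[R]_n) : Prop :=
  [/\ is_process nu I (linproc Phi),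
      forall t s, I t -> I s -> Phi t s \in unitmx &
      forall s, I s -> lipschitz_wrt (opnorm nu) I (fun t => Phi t s)].

Definition is_linearization (R : realType) (n : nat) (I : set R) (tm : R)
    (phi : R -> R -> 'rV[R]_n -> 'rV[R]_n) (x : 'rV[R]_n)
    (Phi : R -> R -> 'M[R]_n) : Prop :=
  forall t s, I t -> I s -> Phi t s = 'J (phi t s) (phi s tm x).

Definition Delta (R : realType) (f : R -> R) (t s : R) : R :=
  (ln (f t) - ln (f s)) / (t - s).

Definition cts_extension (T U : topologicalType) (A B : set T) (f : T -> U) :
  set (T -> U) := [set g | {within B, continuous g} /\ {in A, g =1 f}].

(* (x, (t, s)) |-> Delta (|Phi(., t_-) x|) (t, s) *)
Definition growth (R : realType) (n : nat) (nu : 'rV[R]_n -> R) (tm : R)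
    (Phi : R -> R -> 'M[R]_n) : 'rV[R]_n * (R * R) -> R :=
  fun p => Delta (fun u => nu (linproc Phi u tm p.1)) p.2.1 p.2.2.

Definition growth_extension (R : realType) (n : nat) (nu : 'rV[R]_n -> R)
    (I : set R) (tm : R) (Phi : R -> R -> 'M[R]_n) :
    set ('rV[R]_n * (R * R) -> R) :=
  cts_extension (sphere nu `*` offdiag I) (sphere nu `*` closure (offdiag I))
    (growth nu tm Phi).

Definition LP (R : realType) (n : nat) (nu : 'rV[R]_n -> R) (I : set R)
    (tm : R) (Phi : R -> R -> 'M[R]_n) : Prop :=
  is_linear_process nu I Phi /\ growth_extension nu I tm Phi !=set0.

(* For Phi in LP, the values on sphere nu `*` closure (offdiag I) do not depend
   on the extension picked, as sphere nu `*` offdiag I is dense there. *)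
Definition ext_growth (R : realType) (n : nat) (nu : 'rV[R]_n -> R)
    (I : set R) (tm : R) (Phi : R -> R -> 'M[R]_n) :
    'rV[R]_n * (R * R) -> R :=
  xget (growth nu tm Phi) (growth_extension nu I tm Phi).

Definition Gr (R : realType) (n k : nat) : set {vspace 'rV[R]_n} :=
  [set X | \dim X = k].

Definition growth_values (R : realType) (n : nat) (nu : 'rV[R]_n -> R)
    (I : set R) (tm : R) (X : {vspace 'rV[R]_n}) (Phi : R -> R -> 'M[R]_n) :
    set R :=
  ext_growth nu I tm Phi @`
    (([set` X] `&` sphere nu) `*` closure (offdiag I)).

Definition lambda_lower (R : realType) (n : nat) (nu : 'rV[R]_n -> R)
    (I : set R) (tm : R) (X : {vspace 'rV[R]_n})
    (Phi : R -> R -> 'M[R]_n) : R :=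
  minset (growth_values nu I tm X Phi).

Definition lambda_upper (R : realType) (n : nat) (nu : 'rV[R]_n -> R)
    (I : set R) (tm : R) (X : {vspace 'rV[R]_n})
    (Phi : R -> R -> 'M[R]_n) : R :=
  maxset (growth_values nu I tm X Phi).

Definition Vs (R : realType) (n : nat) (nu : 'rV[R]_n -> R) (I : set R)
    (tm : R) (Phi : R -> R -> 'M[R]_n) : set 'rV[R]_n :=
  \bigcup_(X in Gr 1 `&` [set X | lambda_upper nu I tm X Phi < 0]) [set` X].

Definition Vu (R : realType) (n : nat) (nu : 'rV[R]_n -> R) (I : set R)
    (tm : R) (Phi : R -> R -> 'M[R]_n) : set 'rV[R]_n :=
  \bigcup_(X in Gr 1 `&` [set X | 0 < lambda_lower nu I tm X Phi]) [set` X].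

Definition mu_values (R : realType) (n : nat) (nu : 'rV[R]_n -> R)
    (I : set R) (tm : R) (x : 'rV[R]_n)
    (psi : R -> R -> 'rV[R]_n -> 'rV[R]_n) : set (\bar R) :=
  [set (Delta (fun u => nu (psi u tm x)) p.1 p.2)%:E | p in offdiag I].

Definition mu_lower (R : realType) (n : nat) (nu : 'rV[R]_n -> R)
    (I : set R) (tm : R) (x : 'rV[R]_n)
    (psi : R -> R -> 'rV[R]_n -> 'rV[R]_n) : \bar R :=
  ereal_inf (mu_values nu I tm x psi).

Definition mu_upper (R : realType) (n : nat) (nu : 'rV[R]_n -> R)
    (I : set R) (tm : R) (x : 'rV[R]_n)
    (psi : R -> R -> 'rV[R]_n -> 'rV[R]_n) : \bar R :=
  ereal_sup (mu_values nu I tm x psi).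

(* Meant for 0 <= r only. *)
Definition mdev (R : realType) (n : nat) (nu : 'rV[R]_n -> R) (I : set R)
    (tm : R) (phi : R -> R -> 'rV[R]_n -> 'rV[R]_n)
    (Phi : R -> R -> 'M[R]_n) (r : R) : \bar R :=
  if r == 0 then 0%E else
  ereal_sup [set maxe
      `|mu_lower nu I tm x phi - mu_lower nu I tm x (linproc Phi)|%E
      `|mu_upper nu I tm x phi - mu_upper nu I tm x (linproc Phi)|%E
    | x in cball nu r `\ (0 : 'rV[R]_n)].

Definition Ws0 (R : realType) (n : nat) (nu : 'rV[R]_n -> R) (I : set R)
    (tm : R) (phi : R -> R -> 'rV[R]_n -> 'rV[R]_n) : set 'rV[R]_n :=
  [set x | x != 0 /\ (mu_upper nu I tm x phi < 0)%E] `|` [set 0].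

Definition Wu0 (R : realType) (n : nat) (nu : 'rV[R]_n -> R) (I : set R)
    (tm : R) (phi : R -> R -> 'rV[R]_n -> 'rV[R]_n) : set 'rV[R]_n :=
  [set x | x != 0 /\ (0 < mu_lower nu I tm x phi)%E] `|` [set 0].

Definition Vs_fiber (R : realType) (n : nat) (nu : 'rV[R]_n -> R) (I : set R)
    (tm : R) (Phi : R -> R -> 'M[R]_n) (t : R) : set 'rV[R]_n :=
  linproc Phi t tm @` Vs nu I tm Phi.

Definition Vu_fiber (R : realType) (n : nat) (nu : 'rV[R]_n -> R) (I : set R)
    (tm : R) (Phi : R -> R -> 'M[R]_n) (t : R) : set 'rV[R]_n :=
  linproc Phi t tm @` Vu nu I tm Phi.

Definition Ws0_fiber (R : realType) (n : nat) (nu : 'rV[R]_n -> R) (I : set R)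
    (tm : R) (phi : R -> R -> 'rV[R]_n -> 'rV[R]_n) (t : R) : set 'rV[R]_n :=
  phi t tm @` Ws0 nu I tm phi.

Definition Wu0_fiber (R : realType) (n : nat) (nu : 'rV[R]_n -> R) (I : set R)
    (tm : R) (phi : R -> R -> 'rV[R]_n -> 'rV[R]_n) (t : R) : set 'rV[R]_n :=
  phi t tm @` Wu0 nu I tm phi.

(* inf {r > 0 : exists y in Y of norm 1, r y notin W}; ereal_inf set0 = +oo. *)
Definition exit_radius (R : realType) (n : nat) (nu : 'rV[R]_n -> R)
    (W : set 'rV[R]_n) (Y : {vspace 'rV[R]_n}) : \bar R :=
  ereal_inf [set r%:E | r in
    [set r : R | 0 < r /\
      exists2 y, ([set` Y] `&` sphere nu) y & ~ W (r *: y)]].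

Definition eta_s (R : realType) (n : nat) (nu : 'rV[R]_n -> R) (I : set R)
    (tm : R) (phi : R -> R -> 'rV[R]_n -> 'rV[R]_n) (t : R)
    (Y : {vspace 'rV[R]_n}) : \bar R :=
  exit_radius nu (Ws0_fiber nu I tm phi t) Y.

Definition eta_u (R : realType) (n : nat) (nu : 'rV[R]_n -> R) (I : set R)
    (tm : R) (phi : R -> R -> 'rV[R]_n -> 'rV[R]_n) (t : R)
    (Y : {vspace 'rV[R]_n}) : \bar R :=
  exit_radius nu (Wu0_fiber nu I tm phi t) Y.

(* Main.v *)
Require Import Defs.
From HB Require Import structures.
From mathcomp Require Import all_boot all_order all_algebra.
From mathcomp Require Import all_classical all_reals all_analysis.
From mathcomp Require Import lra.

Set Implicit Arguments.
Unset Strict Implicit.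
Unset Printing Implicit Defensive.

Import Order.TTheory GRing.Theory Num.Theory.
Import numFieldNormedType.Exports.

Local Open Scope classical_set_scope.
Local Open Scope ring_scope.

(** The set of growth rates of the linearization along the line X through x is
    the image of a compact set, namely the two points of the unit sphere on X
    times the closure of the off-diagonal pairs of times. If its maximum is
    below 0, the extended growth rate stays below some - e < 0 on that compact
    set, and by the tube lemma it still does for all directions close to the
    one of x [growth_near]. The linear growth rate depends on the direction
    only [growth_scale], so one neighbourhood of x serves all radii.

    Now let the line Y in the fiber at time t be spanned by y, the image of x.
    The nonlinear trajectory through c y at time t starts at w(c) at time tm,
    and w(c) / c tends to x when c tends to 0, because the linearization is the
    derivative of the process at 0 [ray_derivative]. Hence for small c the
    linear growth rates of w(c) are at most - e. As w(c) itself tends to 0 and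
    m is continuous at 0 with m(0) = 0, the nonlinear and linear rates of w(c)
    differ by less than e [mdev_small], so the nonlinear ones are negative and
    w(c) lies in the domain of attraction. Therefore every c y with c small
    and nonzero lies in the fiber of that domain, which bounds the exit radius
    along Y from below [exit_radius_gt0]. The unstable case is the same argument
    with the inequalities reversed; [exit_radius_fiber_gt0] treats both by
    letting the linear growth rates be confined to an arbitrary open set. *)

(** * Norms on row vectors *)

Lemma is_norm0 (R : realType) (n : nat) (nu : 'rV[R]_n -> R) :
  is_norm nu -> nu 0 = 0.
Proof. by case=> _ nuZ _; rewrite -(scale0r 0) nuZ normr0 mul0r. Qed.

Lemma is_normN (R : realType) (n : nat) (nu : 'rV[R]_n -> R) x :
  is_norm nu -> nu (- x) = nu x.
Proof. by case=> _ nuZ _; rewrite -scaleN1r nuZ normrN1 mul1r. Qed.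

Lemma is_norm_gt0 (R : realType) (n : nat) (nu : 'rV[R]_n -> R) x :
  is_norm nu -> x != 0 -> 0 < nu x.
Proof.
move=> nuP x0; have [nuD nuZ nu_eq0] := nuP.
rewrite lt_def; apply/andP; split.
  by apply: contra x0 => /eqP/nu_eq0/eqP.
have := nuD x (- x); rewrite subrr (is_norm0 nuP) (is_normN _ nuP) -mulr2n.
by rewrite pmulrn_lge0.
Qed.

Lemma is_norm_dist (R : realType) (n : nat) (nu : 'rV[R]_n -> R) x y :
  is_norm nu -> `|nu x - nu y| <= nu (x - y).
Proof.
move=> nuP; have [nuD _ _] := nuP.
have le_sub u v : nu u - nu v <= nu (u - v).
  by rewrite lerBlDr; have := nuD (u - v) v; rewrite subrK.
by rewrite ler_norml lerNl opprB le_sub -(is_normN (x - y) nuP) opprB le_sub.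
Qed.

(** Half of the equivalence of norms: a norm is bounded by a multiple of the
    entrywise maximum norm, hence is continuous for the topology of the
    latter. *)
Lemma is_norm_le (R : realType) (n : nat) (nu : 'rV[R]_n -> R) x :
  is_norm nu -> nu x <= `|x| * \sum_(j < n) nu (delta_mx 0 j).
Proof.
move=> nuP; have [nuD nuZ _] := nuP.
have nu_ge0 v : 0 <= nu v.
  by have [->|/(is_norm_gt0 nuP)/ltW//] := eqVneq v 0; rewrite (is_norm0 nuP).
rewrite {1}(row_sum_delta x) mulr_sumr.
elim/big_ind2 : _ => [|u a v b ua vb|j _]; first by rewrite (is_norm0 nuP).
  exact: le_trans (nuD _ _) (lerD ua vb).
rewrite nuZ ler_wpM2r//.
by rewrite [leRHS]/Num.Def.normr/= mx_normrE; apply: (le_bigmax _ _ (0, j)).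
Qed.

Lemma is_norm_continuous (R : realType) (n : nat) (nu : 'rV[R]_n -> R) :
  is_norm nu -> continuous nu.
Proof.
move=> nuP x; apply/(@cvgrPdist_lt _ _ _ (nbhs x) (nbhs_filter x)) => e e0.
set C := \sum_(j < n) nu (delta_mx 0 j).
(* C vanishes in dimension 0, hence the added 1. *)
have C1 : 0 < `|C| + 1 by rewrite ltr_wpDl.
near=> y.
apply: le_lt_trans (is_norm_dist _ _ nuP) _.
apply: le_lt_trans (is_norm_le _ nuP) _.
apply: (@le_lt_trans _ _ (`|x - y| * (`|C| + 1))).
  by rewrite ler_wpM2l// (le_trans (ler_norm _))// lerDl.
rewrite -ltr_pdivlMr//; near: y.
by apply: (@cvgr_dist_lt _ _ _ (nbhs x) _ id x) => //; rewrite divr_gt0.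
Unshelve. all: by end_near. Qed.

(** * Growth rates of the linear process *)

Lemma Delta_scale (R : realType) (f : R -> R) (a t s : R) :
  0 < a -> 0 < f t -> 0 < f s -> Delta (fun u => a * f u) t s = Delta f t s.
Proof.
move=> a0 ft fs; rewrite /Delta !lnM ?posrE//.
by rewrite opprD addrACA subrr add0r.
Qed.

(** The logarithm turns the factor |c| into an additive constant, which the
    difference quotient cancels. Invertibility keeps the trajectory away from
    0, where the logarithm would not be additive. *)
Lemma growth_scale (R : realType) (n : nat) (nu : 'rV[R]_n -> R) (I : set R)
    (tm : R) (Phi : R -> R -> 'M[R]_n) (c : R) (x : 'rV[R]_n) (p : R * R) :
  is_norm nu -> (forall t, I t -> Phi t tm \in unitmx) ->
  c != 0 -> x != 0 -> offdiag I p ->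
  growth nu tm Phi (c *: x, p) = growth nu tm Phi (x, p).
Proof.
move=> nuP unitPhi c0 x0 [Ip1 Ip2 _]; have [_ nuZ _] := nuP.
have nuPhi t : I t -> 0 < nu (linproc Phi t tm x).
  move=> It; apply: is_norm_gt0 => //; apply: contra_neq x0 => xPhi0.
  by rewrite -(mulmxK (unitPhi _ It) x) [x *m _]xPhi0 mul0mx.
rewrite /growth/= -[RHS](@Delta_scale _ _ `|c|) ?normr_gt0 ?nuPhi//.
by congr Delta; apply/funext => u; rewrite /linproc -scalemxAl nuZ.
Qed.

Lemma compact_closure_offdiag (R : realType) (I : set R) :
  compact I -> compact (closure (offdiag I)).
Proof.
move=> cI; have cII : compact (I `*` I) by exact: compact_setX.
apply: (@subclosed_compact _ _ (I `*` I)) => //; first exact: closed_closure.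
have /closure_id -> : closed (I `*` I).
  by apply: compact_closed cII; exact: norm_hausdorff.
by apply: closureS => p [].
Qed.

(** Tube lemma for the growth rates: their extension is continuous on the
    sphere times the compact closure of the off-diagonal pairs, so an open
    condition that holds on all of the slice over the direction of x persists,
    uniformly in time, over nearby directions. Normalizing extends this from
    unit vectors to a full neighbourhood of x. *)
Lemma growth_near (R : realType) (n : nat) (nu : 'rV[R]_n -> R) (I : set R)
    (tm : R) (Phi : R -> R -> 'M[R]_n) (X : {vspace 'rV[R]_n}) (A : set R)
    (x : 'rV[R]_n) :
  is_norm nu -> compact I -> LP nu I tm Phi -> I tm -> open A ->
  growth_values nu I tm X Phi `<=` A -> x \in X -> x != 0 ->
  \forall w \near x, forall p, offdiag I p -> A (growth nu tm Phi (w, p)).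
Proof.
move=> nuP cI [[_ unitPhi _] ext0] Itm oA XA Xx x0.
have [_ nuZ _] := nuP.
have [gC gE] : growth_extension nu I tm Phi (ext_growth nu I tm Phi).
  by apply: xgetPex.
set g := ext_growth nu I tm Phi in gC gE.
set K := closure (offdiag I) in gC.
have nu_x := is_norm_gt0 nuP x0.
have sphere_normalize w : w != 0 -> sphere nu ((nu w)^-1 *: w).
  move=> w0; have nu_w := is_norm_gt0 nuP w0.
  by rewrite /sphere/= nuZ gtr0_norm ?invr_gt0// mulVf// gt_eqF.
have tube : \forall u \near (nu x)^-1 *: x,
    K `<=` (fun p => sphere nu u -> K p -> A (g (u, p))).
  have /compact_near_coveringP coverK := compact_closure_offdiag cI.
  apply: (coverK _ (nbhs ((nu x)^-1 *: x))
    (fun u p => sphere nu u -> K p -> A (g (u, p)))) => p Kp.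
  have gx : A (g ((nu x)^-1 *: x, p)).
    apply: XA; exists ((nu x)^-1 *: x, p) => //; split => //=; split.
      by rewrite /= memvZ.
    exact: sphere_normalize.
  have su := sphere_normalize _ x0.
  move/subspace_continuousP : gC => /(_ ((nu x)^-1 *: x, p) (conj su Kp)).
  move=> /(_ A (open_nbhs_nbhs (conj oA gx))) [[U V] /= [nU nV] UV].
  exists (V, U) => // -[q u] [/= Vq Uu] sph_u Kq.
  exact: (UV (u, q)).
have normalizeC : (nu w)^-1 *: w @[w --> x] --> (nu x)^-1 *: x.
  have nbhsxF : Filter (nbhs x) := nbhs_filter x.
  have nuC : nu w @[w --> x] --> nu x := is_norm_continuous nuP (x := x).
  have nuVC : (nu w)^-1 @[w --> x] --> (nu x)^-1.
    by apply: cvgV nuC; exact: lt0r_neq0.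
  exact: cvgZ nuVC cvg_id.
have near_neq0 : \forall w \near x, w != 0.
  have : \forall w \near x, 0 < nu w.
    exact: (cvgr_gt _ (is_norm_continuous nuP (x := x))) nu_x.
  apply: filterS => w; apply: contraTneq => ->.
  by rewrite (is_norm0 nuP) ltxx.
near=> w => p offp.
have w0 : w != 0 by near: w.
have nu_w : (nu w)^-1 != 0 by rewrite invr_neq0// gt_eqF// is_norm_gt0.
rewrite -(growth_scale nuP (fun t It => unitPhi t tm It Itm) nu_w w0 offp).
have sw := sphere_normalize _ w0.
have Kp : K p by apply: subset_closure.
rewrite -gE; last by rewrite inE; split.
suff : K `<=` (fun p => sphere nu ((nu w)^-1 *: w) -> K p ->
    A (g ((nu w)^-1 *: w, p))) by exact.
by near: w; exact: (normalizeC _ tube).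
Unshelve. all: by end_near. Qed.

(** A negative value cannot be the default 0 that stands for a missing
    maximum, so it is a genuine maximum. *)
Lemma lambda_upper_lt0 (R : realType) (n : nat) (nu : 'rV[R]_n -> R)
    (I : set R) (tm : R) (X : {vspace 'rV[R]_n}) (Phi : R -> R -> 'M[R]_n) :
  lambda_upper nu I tm X Phi < 0 ->
  ubound (growth_values nu I tm X Phi) (lambda_upper nu I tm X Phi).
Proof.
rewrite /lambda_upper /Defs.maxset; set S := growth_values _ _ _ _ _.
have [exS|noS] := pselect (exists m, is_max S m).
  by move=> _; case: (xgetPex 0 exS).
by rewrite xgetPN ?ltxx// => m mS; apply: noS; exists m.
Qed.

Lemma lambda_lower_gt0 (R : realType) (n : nat) (nu : 'rV[R]_n -> R)
    (I : set R) (tm : R) (X : {vspace 'rV[R]_n}) (Phi : R -> R -> 'M[R]_n) :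
  0 < lambda_lower nu I tm X Phi ->
  lbound (growth_values nu I tm X Phi) (lambda_lower nu I tm X Phi).
Proof.
rewrite /lambda_lower /Defs.minset; set S := growth_values _ _ _ _ _.
have [exS|noS] := pselect (exists m, is_min S m).
  by move=> _; case: (xgetPex 0 exS).
by rewrite xgetPN ?ltxx// => m mS; apply: noS; exists m.
Qed.

(** * Nonlinear growth rates close to zero *)

(** A single radius r with m(r) < e is enough, since m(r) is a supremum over the
    whole punctured ball of radius r. *)
Lemma mdev_small (R : realType) (n : nat) (nu : 'rV[R]_n -> R) (I : set R)
    (tm : R) (phi : R -> R -> 'rV[R]_n -> 'rV[R]_n)
    (Phi : R -> R -> 'M[R]_n) (e : R) :
  mdev nu I tm phi Phi r @[r --> within [set r : R | 0 <= r] (nbhs (0 : R))]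
    --> mdev nu I tm phi Phi 0 ->
  0 < e ->
  exists2 r : R, 0 < r & forall x, x != 0 -> nu x <= r ->
    (`|mu_lower nu I tm x phi - mu_lower nu I tm x (linproc Phi)| < e%:E)%E /\
    (`|mu_upper nu I tm x phi - mu_upper nu I tm x (linproc Phi)| < e%:E)%E.
Proof.
move=> mC e0.
have near_m : \forall r \near (0 : R), 0 <= r ->
    (mdev nu I tm phi Phi r < e%:E)%E.
  apply: (mC [set m | (m < e%:E)%E]); rewrite {1}/mdev eqxx.
  apply: open_nbhs_nbhs; split; first exact: open_ereal_lt_ereal.
  by rewrite /= lte_fin.
have /nbhs_ballP[d /= d0 dP] := near_m.
exists (d / 2) => [|x x0 xd]; first by rewrite divr_gt0.
have d2 : 0 < d / 2 by rewrite divr_gt0.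
have : (mdev nu I tm phi Phi (d / 2) < e%:E)%E.
  apply: dP (ltW d2).
  by rewrite /ball/= sub0r normrN gtr0_norm// ltr_pdivrMr// ltr_pMr// ltr1n.
rewrite /mdev gt_eqF// => md.
apply/andP; rewrite -gt_max; apply: le_lt_trans md.
by apply: ereal_sup_ubound; exists x => //; split => //; exact/eqP.
Qed.

(** Both bounds hold for infinite values too: an infinite a or b that would
    violate the conclusion makes the distance infinite. *)
Lemma lt0_of_dist_lt (R : realType) (a b : \bar R) (e : R) :
  (`|a - b| < e%:E -> b <= (- e)%:E -> a < 0)%E.
Proof.
case: a b => [a||] [b||]//=; rewrite ?lte_fin ?lee_fin ?ltNyr// => ab be.
by have := le_lt_trans (ler_norm _) ab; lra.
Qed.

Lemma gt0_of_dist_lt (R : realType) (a b : \bar R) (e : R) :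
  (`|a - b| < e%:E -> e%:E <= b -> 0 < a)%E.
Proof.
case: a b => [a||] [b||]//=; rewrite ?lte_fin ?lee_fin ?ltry// => ab be.
by rewrite distrC in ab; have := le_lt_trans (ler_norm _) ab; lra.
Qed.

(** * Exit radii and the fibers *)

(** Each unit vector of the line Y is a y with |a| = 1 / nu y, so excluding
    |c| < d excludes the radii below d (nu y), on both half-lines at once. *)
Lemma exit_radius_gt0 (R : realType) (n : nat) (nu : 'rV[R]_n -> R)
    (W : set 'rV[R]_n) (Y : {vspace 'rV[R]_n}) (y : 'rV[R]_n) :
  is_norm nu -> Gr 1 Y -> y \in Y -> y != 0 ->
  (\forall c \near (0 : R)^', W (c *: y)) -> (0 < exit_radius nu W Y)%E.
Proof.
move=> nuP dimY Yy y0; have [_ nuZ _] := nuP.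
have nu_y := is_norm_gt0 nuP y0.
have Yline : <[y]>%VS = Y.
  by apply/eqP; rewrite eqEdim -memvE Yy dim_vline y0 dimY.
move=> /nbhs_ballP[d /= d0 dP].
apply: (@lt_le_trans _ _ (d * nu y)%:E); first by rewrite lte_fin mulr_gt0.
apply/ereal_infP => _ [r [r0 [z [Yz nuz] Wz]] <-].
rewrite lee_fin leNgt; apply/negP => rd; apply: Wz.
move: Yz nuz; rewrite /= -Yline => /vlineP[a ->]; rewrite /sphere/= nuZ => nua.
rewrite scalerA; apply: dP.
  rewrite /ball/= sub0r normrN normrM (gtr0_norm r0).
  by rewrite -(ltr_pM2r nu_y) -mulrA nua mulr1.
rewrite mulf_neq0 ?(gt_eqF r0)//; apply: contra_eq_neq nua => ->.
by rewrite normr0 mul0r eq_sym oner_eq0.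
Qed.

Lemma ray_derivative (R : realType) (n : nat) (f : 'rV[R]_n -> 'rV[R]_n)
    (y : 'rV[R]_n) :
  differentiable f 0 -> f 0 = 0 ->
  c^-1 *: f (c *: y) @[c --> (0 : R)^'] --> y *m 'J f 0.
Proof.
move=> df f0; rewrite mul_rV_lin1 -deriveE//.
have := @diff_derivable _ _ _ _ _ y df; rewrite /derivable /derive f0.
by under eq_fun do rewrite /= addr0 subr0.
Qed.

(** The common core of the stable and the unstable case: A is an open set of
    growth rates that contains those of the linear process along X, and W a set
    which contains all short vectors whose linear growth rates lie in A. The
    starting points w(c) of the trajectories through c y are short and have
    w(c) / c close to x for small c, hence are in W. *)
Lemma exit_radius_fiber_gt0 (R : realType) (n : nat) (nu : 'rV[R]_n -> R)
    (I : set R) (tm t : R) (phi : R -> R -> 'rV[R]_n -> 'rV[R]_n)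
    (Phi : R -> R -> 'M[R]_n) (W : set 'rV[R]_n) (A : set R) (r : R)
    (X Y : {vspace 'rV[R]_n}) (x : 'rV[R]_n) :
  is_norm nu -> compact I -> I tm -> I t -> is_C1process nu I phi ->
  phi t tm 0 = 0 -> LP nu I tm Phi -> is_linearization I tm phi 0 Phi ->
  open A -> 0 < r ->
  (forall w, w != 0 -> nu w <= r ->
    (forall p, offdiag I p -> A (growth nu tm Phi (w, p))) -> W w) ->
  growth_values nu I tm X Phi `<=` A -> x \in X -> x != 0 ->
  Gr 1 Y -> linproc Phi t tm x \in Y ->
  (0 < exit_radius nu (phi t tm @` W) Y)%E.
Proof.
move=> nuP cI Itm It [[_ _ phi_id phi_cocycle] phiC1 _] phi0 LPPhi linPhi.
move=> oA r0 AW XA Xx x0 dimY Yy.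
have [[[_ _ Phi_id Phi_cocycle] unitPhi _] _] := LPPhi.
set y := linproc Phi t tm x in Yy.
have y0 : y != 0.
  apply: contra_neq x0 => yE0.
  by rewrite -(mulmxK (unitPhi _ _ It Itm) x) [x *m _]yE0 mul0mx.
have phi_back0 : phi tm t 0 = 0.
  by rewrite -{1}phi0 phi_cocycle// phi_id.
have ray : c^-1 *: phi tm t (c *: y) @[c --> (0 : R)^'] --> x.
  have -> : x = y *m 'J (phi tm t) 0.
    have := linPhi _ _ Itm It; rewrite phi0 => <-.
    by rewrite -[RHS]/(linproc Phi tm t y) Phi_cocycle// Phi_id.
  by apply: ray_derivative => //; case: (phiC1 _ _ Itm It).
apply: (exit_radius_gt0 nuP dimY Yy y0).
have small : \forall c \near (0 : R)^', nu (phi tm t (c *: y)) <= r.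
  have toward0 : phi tm t (c *: y) @[c --> (0 : R)] --> (0 : 'rV[R]_n).
    have back0 : phi tm t w @[w --> (0 : 'rV[R]_n)] --> (0 : 'rV[R]_n).
      rewrite -{2}phi_back0; apply: differentiable_continuous.
      by case: (phiC1 _ _ Itm It).
    have to0 : c *: y @[c --> (0 : R)] --> (0 : 'rV[R]_n).
      by rewrite -(scale0r y);
        apply: (cvgZ (s := id)); [exact: cvg_id|exact: cvg_cst].
    exact: cvg_comp to0 back0.
  have nu_to0 : nu (phi tm t (c *: y)) @[c --> (0 : R)] --> (0 : R).
    rewrite -{2}(is_norm0 nuP); apply: cvg_comp toward0 _.
    exact: is_norm_continuous.
  by apply: nbhs_dnbhs; exact: cvgr_le nu_to0 _ r0.
have grow := ray _ (growth_near nuP cI LPPhi Itm oA XA Xx x0).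
have c_neq0 : \forall c \near (0 : R)^', c != 0 by exact: nbhs_dnbhs_neq.
near=> c.
have c0 : c != 0 by near: c.
have phi_cy : phi t tm (phi tm t (c *: y)) = c *: y.
  by rewrite phi_cocycle// phi_id.
have w0 : phi tm t (c *: y) != 0.
  apply/eqP => w0; move: phi_cy; rewrite w0 phi0 => /esym/eqP.
  by rewrite scaler_eq0 (negPf c0) (negPf y0).
exists (phi tm t (c *: y)) => //; apply: AW => //; first by near: c.
move=> p offp.
rewrite -(growth_scale nuP (fun t It => unitPhi t tm It Itm)
  (invr_neq0 c0) w0 offp).
move: p offp; near: c; exact: grow.
Unshelve. all: by end_near. Qed.

Lemma Gr1_neq0 (R : realType) (n : nat) (Y : {vspace 'rV[R]_n}) :
  Gr 1 Y -> exists2 y, y \in Y & y != 0.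
Proof.
move=> dimY; exists (vpick Y); first exact: memv_pick.
by rewrite vpick0 -dimv_eq0 dimY.
Qed.

Theorem theorem4p16 (R : realType) (n : nat) (nu : 'rV[R]_n -> R)
    (I : set R) (tm tp : R)
    (phi : R -> R -> 'rV[R]_n -> 'rV[R]_n) (Phi : R -> R -> 'M[R]_n) :
  (1 <= n)%N ->
  is_norm nu ->
  compact I -> is_min I tm -> is_max I tp -> tm < tp ->
  is_C1process nu I phi ->
  (forall t, I t -> phi t tm 0 = 0) ->
  LP nu I tm Phi ->
  is_linearization I tm phi 0 Phi ->
  mdev nu I tm phi Phi r @[r --> within [set r : R | 0 <= r] (nbhs (0 : R))]
    --> mdev nu I tm phi Phi 0 ->
  forall t, I t ->
    (forall Y, Gr 1 Y -> [set` Y] `<=` Vs_fiber nu I tm Phi t ->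
       (0 < eta_s nu I tm phi t Y)%E) /\
    (forall Y, Gr 1 Y -> [set` Y] `<=` Vu_fiber nu I tm Phi t ->
       (0 < eta_u nu I tm phi t Y)%E).
Proof.
move=> _ nuP cI [Itm _] _ _ phiC1 phi0 LPPhi linPhi mC t It.
split=> Y dimY YV.
- have [y Yy y0] := Gr1_neq0 dimY.
  have [x [X [_ /= lamX] Xx] xy] := YV y Yy; rewrite -xy in Yy y0.
  have x0 : x != 0 by apply: contra_neq y0 => ->; rewrite /linproc mul0mx.
  have maxX := lambda_upper_lt0 lamX.
  (* Half the gap to 0 bounds the linear rates, the other half absorbs the
     deviation of the nonlinear ones. *)
  pose e := - lambda_upper nu I tm X Phi / 2.
  have e0 : 0 < e by rewrite divr_gt0// oppr_gt0.
  have [r r0 rP] := mdev_small mC e0.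
  apply: (exit_radius_fiber_gt0 nuP cI Itm It phiC1 (phi0 t It) LPPhi linPhi
    (@open_lt _ (- e)) r0 _ _ Xx x0 dimY Yy) => [w w0 wr Aw|v /maxX].
    left; split => //; apply: lt0_of_dist_lt (rP w w0 wr).2 _.
    by apply/ereal_supP => _ [p offp <-]; rewrite lee_fin; exact/ltW/Aw.
  rewrite /=; move: lamX; rewrite /e; lra.
- have [y Yy y0] := Gr1_neq0 dimY.
  have [x [X [_ /= lamX] Xx] xy] := YV y Yy; rewrite -xy in Yy y0.
  have x0 : x != 0 by apply: contra_neq y0 => ->; rewrite /linproc mul0mx.
  have minX := lambda_lower_gt0 lamX.
  pose e := lambda_lower nu I tm X Phi / 2.
  have e0 : 0 < e by rewrite divr_gt0.
  have [r r0 rP] := mdev_small mC e0.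
  apply: (exit_radius_fiber_gt0 nuP cI Itm It phiC1 (phi0 t It) LPPhi linPhi
    (@open_gt _ e) r0 _ _ Xx x0 dimY Yy) => [w w0 wr Aw|v /minX].
    left; split => //; apply: gt0_of_dist_lt (rP w w0 wr).1 _.
    by apply/ereal_infP => _ [p offp <-]; rewrite lee_fin; exact/ltW/Aw.
  rewrite /=; move: lamX; rewrite /e; lra.
Qed.
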